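(* Consider the family of $E_6$-type fibrations $x^3+y^3=d\,xyz+e\,xz^2+f\,yz^2+g\,z^3$, depending on a scalar parameter $C$, given by $$d=6k,\qquad e=9k^2+3h,\qquad f=9k^2+3h+C\phi,\qquad g=2k(5k^2+3h)+C(\gamma+k\phi),$$ with $k,h,\phi,\gamma$ general sections of $\mathscr L,\mathscr L^2,\mathscr L^2,\mathscr L^3$ over the base $B$. Then, up to nonzero numerical constants and at leading order in $C$ as $C\to0$, the discriminant $\Delta$ and the $j$-invariant satisfy $$\Delta\sim C^2\,h^2(h+3k^2)(\gamma^2-h\phi^2),\qquad j\sim\frac1{C^2}\cdot\frac{h^4}{(h+3k^2)(\gamma^2-h\phi^2)}.$$
   Context: $\mathscr L$ is a line bundle on a nonsingular compact complex variety $B$. The Weierstrass model of the cubic $x^3+y^3=d\,xyz+e\,xz^2+f\,yz^2+g\,z^3$ is $y^2+x^3+Fx+G=0$ with $F=-3ef+\frac92dg-\frac1{48}d^4$ and $G=-e^3-f^3+\frac{27}4g^2+\frac34efd^2-\frac58gd^3-\frac1{864}d^6$; its discriminant is $\Delta=4F^3+27G^2$ and its $j$-invariant is, up to a nonzero constant factor, $F^3/\Delta$. ''$\Delta\sim C^2A$ at leading order in $C$'' means that $\Delta$, as a polynomial in $C$, has the form (nonzero constant)$\,\cdot C^2A+O(C^3)$, and the statement for $j$ is understood as the quotient of the leading terms of $F^3$ and $\Delta$. *)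

(* Defs.v *)
From mathcomp Require Import all_boot all_order all_algebra.
From mathcomp Require Import complex.
From mathcomp Require Import boolp classical_sets functions reals topology.
From mathcomp Require Import normedtype landau derive.

Set Implicit Arguments.
Unset Strict Implicit.
Unset Printing Implicit Defensive.

Import Order.TTheory GRing.Theory Num.Theory.
Import numFieldNormedType.Exports.

Local Open Scope classical_set_scope.
Local Open Scope ring_scope.

(* The complex numbers, packed so that the topology and norm which
   MathComp-Analysis puts on every numFieldType are inferred. *)
Definition CC (R : realType) : numClosedFieldType := R[i].

(* A nonsingular compact complex variety, as a compact connected Hausdorff
   complex manifold of dimension n.  Differentiability is over CC R, so on open
   sets it is holomorphy.  Only the values of [chart a] on [cdom a] and of
   [chart_inv a] on its image matter. *)
Record compactComplexManifold (R : realType) (n : nat) := CompactComplexManifold {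
  cspace :> topologicalType ;
  cidx : Type ;
  cdom : cidx -> set cspace ;
  chart : cidx -> cspace -> 'rV[CC R]_n ;
  chart_inv : cidx -> 'rV[CC R]_n -> cspace ;
  cdom_open : forall a, open (cdom a) ;
  cdom_cover : forall x, exists a, cdom a x ;
  chart_open : forall a, open (chart a @` cdom a) ;
  chartK : forall a x, cdom a x -> chart_inv a (chart a x) = x ;
  chart_continuous : forall a x, cdom a x -> {for x, continuous (chart a)} ;
  chart_inv_continuous : forall a x, cdom a x ->
    {for chart a x, continuous (chart_inv a)} ;
  chart_holomorphic : forall a b x, cdom a x -> cdom b x ->
    differentiable (fun z => chart b (chart_inv a z)) (chart a x) ;
  cspace_hausdorff : hausdorff_space cspace ;
  cspace_compact : compact [set: cspace] ;
  cspace_connected : connected [set: cspace] ;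
  cspace_nonempty : [set: cspace] !=set0
}.

(* Meant for open U: the values of s outside U are then irrelevant. *)
Definition holomorphic_on (R : realType) (n : nat)
    (B : compactComplexManifold R n) (U : set B) (s : B -> CC R) : Prop :=
  forall (a : cidx B) (x : B), U x -> cdom a x ->
    differentiable (fun z : 'rV[CC R]_n => s (chart_inv a z)) (chart a x).

(* A holomorphic line bundle, presented by its transition functions: a section
   has components with s_i = g_ij s_j on U_i `&` U_j. *)
Record lineBundle (R : realType) (n : nat) (B : compactComplexManifold R n) :=
  LineBundle {
    lidx : Type ;
    ldom : lidx -> set B ;
    ltrans : lidx -> lidx -> B -> CC R ;
    ldom_open : forall i, open (ldom i) ;
    ldom_cover : forall x, exists i, ldom i x ;
    ltrans_holomorphic : forall i j,
      holomorphic_on (ldom i `&` ldom j) (ltrans i j) ;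
    ltrans_neq0 : forall i j x, ldom i x -> ldom j x -> ltrans i j x != 0 ;
    ltrans_cocycle : forall i j l x, ldom i x -> ldom j x -> ldom l x ->
      ltrans i j x * ltrans j l x = ltrans i l x
  }.

(* Holomorphic sections of L^m, the line bundle with transition functions
   g_ij ^+ m.  [s i] is meaningful only on [ldom i], so two sections are the
   same when they agree there for all i. *)
Record section (R : realType) (n : nat) (B : compactComplexManifold R n)
    (L : lineBundle B) (m : nat) := Section {
  sval_at :> lidx L -> B -> CC R ;
  section_holomorphic : forall i, holomorphic_on (ldom i) (sval_at i) ;
  section_glue : forall i j x, ldom i x -> ldom j x ->
    sval_at i x = ltrans i j x ^+ m * sval_at j x
}.

Section SectionOps.
Context {R : realType} {n : nat} {B : compactComplexManifold R n}.
Context {L : lineBundle B}.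

Fact sadd_holomorphic m (s t : section L m) i :
  holomorphic_on (ldom i) (fun x => s i x + t i x).
Proof.
move=> a x Ux ax; apply: differentiableD; exact: section_holomorphic.
Qed.

Fact sadd_glue m (s t : section L m) i j x : ldom i x -> ldom j x ->
  s i x + t i x = ltrans i j x ^+ m * (s j x + t j x).
Proof. by move=> ix jx; rewrite mulrDr -!section_glue. Qed.

Definition sadd m (s t : section L m) : section L m :=
  Section (sadd_holomorphic s t) (sadd_glue s t).

Fact smul_holomorphic p q (s : section L p) (t : section L q) i :
  holomorphic_on (ldom i) (fun x => s i x * t i x).
Proof.
move=> a x Ux ax; apply: differentiableM; exact: section_holomorphic.
Qed.

Fact smul_glue p q (s : section L p) (t : section L q) i j x :
  ldom i x -> ldom j x ->
  s i x * t i x = ltrans i j x ^+ (p + q) * (s j x * t j x).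
Proof. by move=> ix jx; rewrite exprD mulrACA -!section_glue. Qed.

Definition smul p q (s : section L p) (t : section L q) : section L (p + q) :=
  Section (smul_holomorphic s t) (smul_glue s t).

Fact sscale_holomorphic m (c : CC R) (s : section L m) i :
  holomorphic_on (ldom i) (fun x => c * s i x).
Proof.
move=> a x Ux ax; apply: differentiableM; last exact: section_holomorphic.
exact: differentiable_cst.
Qed.

Fact sscale_glue m (c : CC R) (s : section L m) i j x : ldom i x -> ldom j x ->
  c * s i x = ltrans i j x ^+ m * (c * s j x).
Proof. by move=> ix jx; rewrite mulrCA -section_glue. Qed.

Definition sscale m (c : CC R) (s : section L m) : section L m :=
  Section (sscale_holomorphic c s) (sscale_glue c s).

End SectionOps.

Declare Scope section_scope.
Delimit Scope section_scope with sec.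
Bind Scope section_scope with section.

(* The degrees below are closed natural numbers, so that for instance
   [section L (2 + 2)] and [section L 4] are convertible. *)
Notation "s + t" := (sadd s t) : section_scope.
Notation "s * t" := (smul s t) : section_scope.
Notation "c *: s" := (sscale c%R s) : section_scope.
Notation "s - t" := (sadd s (sscale (- 1)%R t)) : section_scope.
Notation "s ^2" := (smul s s)
  (at level 1, left associativity, format "s ^2") : section_scope.
Notation "s ^3" := (smul s (smul s s))
  (at level 1, left associativity, format "s ^3") : section_scope.

(* The fibration x^3 + y^3 = d x y z + e x z^2 + f y z^2 + g z^3 over B. *)
Record E6Fibration (R : realType) (n : nat) (B : compactComplexManifold R n)
    (L : lineBundle B) := mkE6Fibration {
  E6_d : section L 1 ;
  E6_e : section L 2 ;
  E6_f : section L 2 ;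
  E6_g : section L 3
}.

Section Weierstrass.
Context {R : realType} {n : nat} {B : compactComplexManifold R n}.
Context {L : lineBundle B}.
Local Open Scope section_scope.

(* The Weierstrass model y^2 + x^3 + F x + G = 0. *)
Definition weierstrassF (X : E6Fibration L) : section L 4 :=
  let: mkE6Fibration d e f g := X in
  (- 3) *: (e * f) + (9 / 2) *: (d * g) - (1 / 48) *: (d^2)^2.

Definition weierstrassG (X : E6Fibration L) : section L 6 :=
  let: mkE6Fibration d e f g := X in
  (- 1) *: e^3 - f^3 + (27 / 4) *: g^2 + (3 / 4) *: ((e * f) * d^2)
  - (5 / 8) *: (g * d^3) - (1 / 864) *: (d^2)^3.

Definition discriminant (X : E6Fibration L) : section L 12 :=
  4 *: (weierstrassF X)^3 + 27 *: (weierstrassG X)^2.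

Definition E6_family (k : section L 1) (h phi : section L 2)
    (gamma : section L 3) (C : CC R) : E6Fibration L :=
  {| E6_d := 6 *: k ;
     E6_e := 9 *: k^2 + 3 *: h ;
     E6_f := 9 *: k^2 + 3 *: h + C *: phi ;
     E6_g := 2 *: (k * (5 *: k^2 + 3 *: h)) + C *: (gamma + k * phi) |}.

End Weierstrass.

Section LeadingOrder.
Context {R : realType} {n : nat} {B : compactComplexManifold R n}.
Context {L : lineBundle B}.

Definition nonzero_section m (s : section L m) : Prop :=
  exists i x, ldom i x /\ s i x != 0.

(* P is polynomial in C and P = C^p A + O(C^(p+1)); the coefficients S_l of the
   remainder are again sections.  When A is a nonzero section, p and A are
   determined by P. *)
Definition leading_form m (P : CC R -> section L m) (p : nat)
    (A : section L m) : Prop :=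
  exists (N : nat) (S : 'I_N -> section L m),
    forall (C : CC R) i x, ldom i x ->
      P C i x = C ^+ p * A i x + C ^+ p.+1 * \sum_(l < N) C ^+ l * S l i x.

(* q is the quotient of the leading terms of P and Q; it is a family of
   meromorphic functions on B, compared away from the zeros of the leading
   coefficient of Q. *)
Definition leading_quotient m (P Q : CC R -> section L m)
    (q : CC R -> lidx L -> B -> CC R) : Prop :=
  exists (p p' : nat) (A A' : section L m),
    [/\ nonzero_section A, nonzero_section A',
        leading_form P p A, leading_form Q p' A' &
        forall C i x, C != 0 -> ldom i x -> A' i x != 0 ->
          q C i x = (C ^+ p * A i x) / (C ^+ p' * A' i x)].

(* The j-invariant is F^3 / discriminant up to a nonzero constant factor. *)
Definition j_leading (X : CC R -> E6Fibration L)
    (q : CC R -> lidx L -> B -> CC R) : Prop :=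
  leading_quotient (fun C => (weierstrassF (X C))^3%sec)
    (fun C => discriminant (X C)) q.

End LeadingOrder.

(* Main.v *)
Require Import Defs.
From mathcomp Require Import all_boot all_order all_algebra.
From mathcomp Require Import boolp classical_sets reals topology normedtype.
From mathcomp Require Import ring.

Set Implicit Arguments.
Unset Strict Implicit.
Unset Printing Implicit Defensive.

Local Open Scope ring_scope.

(** With m = 3 k gamma - h phi, the Weierstrass coefficients of the family are
    F = -27 h^2 + 9 m C and G = -54 h^3 + 27 h m C + G2 C^2 - phi^3 C^3.
    At C = 0 the cubic 4 F^3 + 27 G^2 vanishes identically, the terms of order C
    cancel because (F, G) moves tangentially to the cuspidal curve, and
    the C^2 coefficient -6561 h^2 m^2 - 2916 h^3 G2 factors as
    -19683 h^2 (h + 3 k^2) (gamma^2 - h phi^2).  As F^3 starts with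
    -19683 h^6, the two constants cancel in j. *)

Lemma foldr_horner (K : pzRingType) (T : Type) (v : T -> K) (c : K)
    (s : seq T) :
  foldr (fun t r => v t + c * r) 0 s =
  \sum_(l < size s) c ^+ l * v (tnth (in_tuple s) l).
Proof.
elim: s => [|t s IHs] /=; first by rewrite big_ord0.
rewrite big_ord_recl GRing.expr0 GRing.mul1r (tnth_nth t) /= IHs.
rewrite GRing.mulr_sumr; congr (_ + _); apply: eq_bigr => l _.
by rewrite !(tnth_nth t) /= GRing.exprS GRing.mulrA.
Qed.

(** Used with y = h and z = (h + 3 k^2)(gamma^2 - h phi^2): the shared constant a cancels and h^6 /
    h^2 leaves h^4. The products are bracketed as section powers unfold. *)
Lemma leading_terms_quotient (K : fieldType) (a c y z : K) :
    a != 0 -> c != 0 -> y != 0 -> z != 0 ->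
  1 * (1 / c ^+ 2 * (y ^+ 4 / z)) =
  c ^+ 0 * (a * (y * (y * y) * (y * (y * y)))) /
    (c ^+ 2 * (a * (y * y * z))).
Proof. by move=> a0 c0 y0 z0; field; rewrite a0 c0 y0 z0. Qed.

Section Pointwise.
Context {R : realType} {n : nat} {B : compactComplexManifold R n}.
Context {L : lineBundle B}.

Lemma cubeE m (s : section L m) i x : (s^3)%sec i x = s i x ^+ 3.
Proof. by []. Qed.

Lemma discriminantE (X : E6Fibration L) i x :
  discriminant X i x =
  4 * weierstrassF X i x ^+ 3 + 27 * weierstrassG X i x ^+ 2.
Proof. by []. Qed.

(** With the remainder in Horner form over an explicit list, each expansion becomes a polynomial
    identity at a point, with no indexed sum. *)
Lemma leading_form_horner m (P : CC R -> section L m) p (A : section L m)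
    (s : seq (section L m)) :
  (forall C i x, P C i x = C ^+ p * A i x
     + C ^+ p.+1 * foldr (fun (t : section L m) r => t i x + C * r) 0 s) ->
  leading_form P p A.
Proof.
move=> PE; exists (size s), (tnth (in_tuple s)) => C i x _.
by rewrite PE foldr_horner.
Qed.

End Pointwise.

Section ExpansionInC.
Context {R : realType} {n : nat} {B : compactComplexManifold R n}.
Context {L : lineBundle B}.
Variables (k : section L 1) (h phi : section L 2) (gamma : section L 3).

Definition coefF1 : section L 4 :=
  (9 *: (3 *: (k * gamma) - h * phi))%sec.

Definition coefG1 : section L 6 :=
  (27 *: (h * (3 *: (k * gamma) - h * phi)))%sec.

(** Only [g^2] and [f^3] reach order C^2; the latter gives -3 (9 k^2 + 3 h) phi^2. *)
Definition coefG2 : section L 6 :=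
  ((27 / 4) *: (gamma + k * phi)^2 - 27 *: (k * phi)^2
   - 9 *: (h * phi^2))%sec.

(* Simplification leaves an equality at the carrier R[i]; the cast puts it back
   at CC R, where the algebraic structures are found. *)
Lemma weierstrassF_family (C : CC R) i x :
  weierstrassF (E6_family k h phi gamma C) i x =
  - 27 * h i x ^+ 2 + C * coefF1 i x.
Proof. by rewrite /=; refine (_ : _ = _ :> CC R); field. Qed.

Lemma weierstrassG_family (C : CC R) i x :
  weierstrassG (E6_family k h phi gamma C) i x =
  - 54 * h i x ^+ 3 + C * coefG1 i x + C ^+ 2 * coefG2 i x
  - C ^+ 3 * phi i x ^+ 3.
Proof. by rewrite /=; refine (_ : _ = _ :> CC R); field. Qed.

Lemma weierstrassF_cube_leading :
  leading_form (fun C => (weierstrassF (E6_family k h phi gamma C))^3%sec) 0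
    (- 19683 *: (h^3)^2)%sec.
Proof.
(* Binomial expansion of (-27 h^2 + C [coefF1])^3: 2187 = 3 * 27^2 and 81 = 3 * 27. *)
apply: (leading_form_horner (s := [:: (2187 *: ((h^2)^2 * coefF1))%sec;
  (- 81 *: (h^2 * coefF1^2))%sec; (coefF1^3)%sec])) => C i x.
rewrite [LHS]cubeE weierstrassF_family /=.
by refine (_ : _ = _ :> CC R); ring.
Qed.

Lemma discriminant_leading :
  leading_form (fun C => discriminant (E6_family k h phi gamma C)) 2
    (- 19683 *: (h^2 * ((h + 3 *: k^2) * (gamma^2 - h * phi^2))))%sec.
Proof.
(* Coefficients of C^3 to C^6. As F is linear in C, 4 F^3 enters only the first of them; the rest
   comes from 27 G^2. *)
apply: (leading_form_horner (s := [::
  (4 *: coefF1^3 + 54 *: (54 *: (h^3 * phi^3) + coefG1 * coefG2))%sec;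
  (27 *: coefG2^2 - 54 *: (coefG1 * phi^3))%sec;
  (- 54 *: (coefG2 * phi^3))%sec; (27 *: (phi^3)^2)%sec])) => C i x.
rewrite discriminantE weierstrassF_family weierstrassG_family /=.
by refine (_ : _ = _ :> CC R); field.
Qed.

End ExpansionInC.

(** Where h^2 D is nonzero so is h, hence also a h^6: one nonvanishing assumption serves both
    leading coefficients. *)
Lemma j_leading_quotient (R : realType) (n : nat)
    (B : compactComplexManifold R n) (L : lineBundle B)
    (X : CC R -> E6Fibration L) (a : CC R) (h : section L 2) (D : section L 8) :
    a != 0 -> nonzero_section (h^2 * D)%sec ->
    leading_form (fun C => (weierstrassF (X C))^3%sec) 0 (a *: (h^3)^2)%sec ->
    leading_form (fun C => discriminant (X C)) 2 (a *: (h^2 * D))%sec ->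
  j_leading X (fun C i x => 1 * (1 / C ^+ 2 * (h i x ^+ 4 / D i x))).
Proof.
move=> a0 [i0 [x0 [Ux0 hD0]]] F3_leading Delta_leading.
have factors_neq0 i x : h i x * h i x * D i x != 0 -> h i x != 0 /\ D i x != 0.
  by rewrite !GRing.mulf_eq0 !negb_or => /andP[/andP[]].
have [h0 _] := factors_neq0 _ _ hD0.
exists 0%N, 2%N, (a *: (h^3)^2)%sec, (a *: (h^2 * D))%sec; split.
- have h3 := GRing.expf_neq0 3 h0.
  exists i0, x0; split=> //.
  exact: (GRing.mulf_neq0 a0 (GRing.mulf_neq0 h3 h3)).
- by exists i0, x0; split=> //; exact: (GRing.mulf_neq0 a0 hD0).
- exact: F3_leading.
- exact: Delta_leading.
(* Values are compared only off the zeros of a h^2 D, so h^2 may be cancelled. *)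
move=> C i x C0 _ aD0.
have [hx Dx] : h i x != 0 /\ D i x != 0.
  by apply: factors_neq0; apply: contraNneq aD0 => /= ->; rewrite GRing.mulr0.
exact: leading_terms_quotient.
Qed.

Theorem mainTheorem14 (R : realType) :
  exists cD cj : CC R, cD != 0 /\ cj != 0 /\
  forall (n : nat) (B : compactComplexManifold R n) (L : lineBundle B)
    (k : section L 1) (h phi : section L 2) (gamma : section L 3),
  let A : section L 12 :=
    (h^2 * ((h + 3 *: k^2) * (gamma^2 - h * phi^2)))%sec in
  let D : section L 8 := ((h + 3 *: k^2) * (gamma^2 - h * phi^2))%sec in
  leading_form (fun C => discriminant (E6_family k h phi gamma C)) 2
    (sscale cD A) /\
  (nonzero_section A ->
   j_leading (E6_family k h phi gamma)
     (fun C i x => cj * (1 / C ^+ 2 * (h i x ^+ 4 / D i x)))).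
Proof.
have c_neq0 : (- 19683 : CC R) != 0.
  by rewrite GRing.oppr_eq0 Num.Theory.pnatr_eq0.
(* -19683 = (-27)^3 heads both F^3 and the discriminant, hence 1 for j. *)
exists (- 19683), 1; split; first exact: c_neq0.
split; first exact: GRing.oner_neq0.
move=> n B L k h phi gamma A D; split; first exact: discriminant_leading.
move=> A0; apply: (j_leading_quotient c_neq0 A0).
  exact: weierstrassF_cube_leading.
exact: discriminant_leading.
Qed.
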